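(* Local confluence is undecidable for terminating LCTRSs: there is no algorithm which, given (a finite presentation of) a terminating LCTRS $\mathcal{R}$, decides whether $\mathcal{R}$ is locally confluent.
   Context: Logically constrained rewriting. Fix a many-sorted signature $\mathcal{F}=\mathcal{F}_{\mathrm{te}}\cup\mathcal{F}_{\mathrm{th}}$ (possibly infinite) and an infinite set $\mathcal{V}$ of sorted variables. For every sort $\iota$ of $\mathcal{F}_{\mathrm{th}}$ there is a non-empty set $\mathcal{V}\mathrm{al}_\iota\subseteq\mathcal{F}_{\mathrm{th}}$ of constants of sort $\iota$, called values; $\mathcal{V}\mathrm{al}=\bigcup_\iota\mathcal{V}\mathrm{al}_\iota$ and $\mathcal{F}_{\mathrm{te}}\cap\mathcal{F}_{\mathrm{th}}\subseteq\mathcal{V}\mathrm{al}$. Terms in $\mathcal{T}(\mathcal{F}_{\mathrm{th}},\mathcal{V})$ are logical terms; a fixed interpretation $\mathcal{J}$ evaluates ground logical terms to values via $[\![f(t_1,\dots,t_n)]\!]=f_{\mathcal{J}}([\![t_1]\!],\dots,[\![t_n]\!])$. Logical terms of sort $\mathsf{bool}$ are constraints (the theory contains the usual connectives and an equality $=$). A constraint $\varphi$ is valid if $[\![\varphi\gamma]\!]=\top$ for all substitutions $\gamma$ with $\gamma(x)\in\mathcal{V}\mathrm{al}$ for all $x\in\mathcal{V}\mathrm{ar}(\varphi)$. A constrained rewrite rule $\rho\colon \ell\to r\ [\varphi]$ consists of terms $\ell,r\in\mathcal{T}(\mathcal{F},\mathcal{V})$ of the same sort with $\mathrm{root}(\ell)\in\mathcal{F}_{\mathrm{te}}\setminus\mathcal{F}_{\mathrm{th}}$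 and a constraint $\varphi$; $\mathcal{LV}\mathrm{ar}(\rho)=\mathcal{V}\mathrm{ar}(\varphi)\cup(\mathcal{V}\mathrm{ar}(r)\setminus\mathcal{V}\mathrm{ar}(\ell))$. An LCTRS $\mathcal{R}$ is a set of constrained rewrite rules. A substitution $\sigma$ respects $\rho$, written $\sigma\vDash\rho$, if $\mathcal{D}\mathrm{om}(\sigma)=\mathcal{V}\mathrm{ar}(\ell)\cup\mathcal{V}\mathrm{ar}(r)\cup\mathcal{V}\mathrm{ar}(\varphi)$, $\sigma(x)\in\mathcal{V}\mathrm{al}$ for all $x\in\mathcal{LV}\mathrm{ar}(\rho)$, and $\varphi\sigma$ is valid. For every $f\in\mathcal{F}_{\mathrm{th}}\setminus\mathcal{V}\mathrm{al}$ the calculation rule is $f(x_1,\dots,x_n)\to y\ [y=f(x_1,\dots,x_n)]$ with $y$ fresh; $\mathcal{R}_{\mathrm{rc}}$ is $\mathcal{R}$ together with all calculation rules. The rewrite relation: $s\to_{\mathcal{R}}t$ if $s|_p=\ell\sigma$ and $t=s[r\sigma]_p$ for some position $p$, rule $\rho\colon\ell\to r\ [\varphi]\in\mathcal{R}_{\mathrm{rc}}$ and $\sigma\vDash\rho$. $\mathcal{R}$ is terminating if there is no infinite $\to_{\mathcal{R}}$-sequence, and locally confluent if whenever $t\leftarrow_{\mathcal{R}}s\to_{\mathcal{R}}u$ there is $v$ with $t\to_{\mathcal{R}}^*v\;{}^*\!\!\leftarrow_{\mathcal{R}}u$. *)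

(* Defs.v *)
From HB Require Import structures.
From mathcomp Require Import all_boot all_order all_algebra.
From Stdlib Require List.
From Stdlib Require Import Relations.

Set Implicit Arguments.
Unset Strict Implicit.
Unset Printing Implicit Defensive.

Import Order.TTheory GRing.Theory Num.Theory.

(** * Terms *)

(* Raw terms over sorts [S] and function symbols [F]; well-sortedness is the
   predicate [has_sort] below.  Variables are pairs of a sort and an index, so
   that there are infinitely many variables of every sort. *)
Inductive term (S F : Type) : Type :=
| Var of S * nat
| App of F & seq (term S F).
Arguments Var {S F} _.
Arguments App {S F} _ _.

(* A substitution is a partial map whose domain is the set of variables on
   which it is defined (a variable in the domain may be mapped to itself);
   outside of its domain it acts as the identity. *)
Definition substitution (S F : Type) := S * nat -> option (term S F).

Fixpoint subst (S F : Type) (sigma : substitution S F) (t : term S F) :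
    term S F :=
  match t with
  | Var x => odflt (Var x) (sigma x)
  | App f ts => App f (map (subst sigma) ts)
  end.

Fixpoint vars (S F : Type) (t : term S F) : seq (S * nat) :=
  match t with
  | Var x => [:: x]
  | App _ ts => flatten (map (@vars S F) ts)
  end.

Fixpoint subterm_at (S F : Type) (t : term S F) (p : seq nat) :
    option (term S F) :=
  match p with
  | [::] => Some t
  | i :: q =>
    match t with
    | Var _ => None
    | App _ ts => if onth ts i is Some u then subterm_at u q else None
    end
  end.

(* Only used at positions [p] of [t]. *)
Fixpoint replace_at (S F : Type) (t : term S F) (p : seq nat) (u : term S F) :
    term S F :=
  match p with
  | [::] => u
  | i :: q =>
    match t with
    | Var _ => t
    | App f ts =>
      if onth ts i is Some ti then App f (set_nth ti ts i (replace_at ti q u))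
      else t
    end
  end.

Record rule (S F : Type) := Rule {
  lhs : term S F;
  rhs : term S F;
  cond : term S F }.

(** * Logically constrained rewriting *)

(* The signature is the set of symbols in [is_te] or [is_th].  The interpretation
   [interp f] is only meaningful on lists of values whose sorts are those of
   the arguments of the theory symbol [f]. *)
Record signature := Signature {
  srt : eqType;
  sym : Type;
  args : sym -> seq srt;
  res : sym -> srt;
  is_te : pred sym;
  is_th : pred sym;
  is_val : pred sym;
  th_sort : srt -> Prop := fun i => exists2 f, is_th f & i \in res f :: args f;
  interp : sym -> seq sym -> sym;
  sbool : srt;
  vtop : sym;
  vbot : sym;
  lneg : sym;
  land : sym;
  lor : sym;
  limp : sym;
  eqs : srt -> sym;
  val_th : forall v, is_val v -> is_th v;
  val_const : forall v, is_val v -> args v = [::];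
  val_inhabited : forall i, th_sort i -> exists2 v, is_val v & res v = i;
  te_th_val : forall f, is_te f -> is_th f -> is_val f;
  interp_val : forall v, is_val v -> interp v [::] = v;
  interp_sort : forall f vs, is_th f -> all is_val vs -> map res vs = args f ->
    is_val (interp f vs) /\ res (interp f vs) = res f;
  bool_val : forall v, (is_val v /\ res v = sbool) <-> (v = vtop \/ v = vbot);
  top_neq_bot : vtop <> vbot;
  neg_spec : [/\ is_th lneg, args lneg = [:: sbool], res lneg = sbool &
    interp lneg [:: vtop] = vbot /\ interp lneg [:: vbot] = vtop];
  conj_spec : [/\ is_th land, args land = [:: sbool; sbool], res land = sbool &
    [/\ interp land [:: vtop; vtop] = vtop, interp land [:: vtop; vbot] = vbot,
        interp land [:: vbot; vtop] = vbot & interp land [:: vbot; vbot] = vbot]];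
  disj_spec : [/\ is_th lor, args lor = [:: sbool; sbool], res lor = sbool &
    [/\ interp lor [:: vtop; vtop] = vtop, interp lor [:: vtop; vbot] = vtop,
        interp lor [:: vbot; vtop] = vtop & interp lor [:: vbot; vbot] = vbot]];
  impl_spec : [/\ is_th limp, args limp = [:: sbool; sbool], res limp = sbool &
    [/\ interp limp [:: vtop; vtop] = vtop, interp limp [:: vtop; vbot] = vbot,
        interp limp [:: vbot; vtop] = vtop & interp limp [:: vbot; vbot] = vtop]];
  eqs_spec : forall i, th_sort i ->
    [/\ is_th (eqs i), args (eqs i) = [:: i; i], res (eqs i) = sbool &
      forall v w, is_val v -> is_val w -> res v = i -> res w = i ->
        (v = w -> interp (eqs i) [:: v; w] = vtop) /\
        (v <> w -> interp (eqs i) [:: v; w] = vbot)] }.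

Definition sterm (Sg : signature) := term (srt Sg) (sym Sg).
Definition srule (Sg : signature) := rule (srt Sg) (sym Sg).
Definition ssubst (Sg : signature) := substitution (srt Sg) (sym Sg).

Fixpoint has_sort (Sg : signature) (t : term (srt Sg) (sym Sg)) (i : srt Sg) :
    bool :=
  match t with
  | Var x => x.1 == i
  | App f ts =>
    [&& is_te f || is_th f, res f == i & all2 (@has_sort Sg) ts (args f)]
  end.

Definition is_term (Sg : signature) (t : sterm Sg) : Prop :=
  exists i, has_sort t i.

Fixpoint only_theory (Sg : signature) (t : term (srt Sg) (sym Sg)) : bool :=
  match t with
  | Var _ => true
  | App f ts => is_th f && all (@only_theory Sg) ts
  end.

Definition is_constraint (Sg : signature) (phi : sterm Sg) : bool :=
  has_sort phi (sbool Sg) && only_theory phi.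

Definition is_rule (Sg : signature) (rho : srule Sg) : Prop :=
  [/\ exists i, has_sort (lhs rho) i && has_sort (rhs rho) i,
      exists f ts, lhs rho = App f ts /\ is_te f && ~~ is_th f
    & is_constraint (cond rho)].

Definition is_subst (Sg : signature) (sigma : ssubst Sg) : Prop :=
  forall x t, sigma x = Some t -> has_sort t x.1.

Definition maps_to_value (Sg : signature) (sigma : ssubst Sg)
    (x : srt Sg * nat) : Prop :=
  exists2 v, is_val v & sigma x = Some (App v [::]).

Fixpoint all_some (T : Type) (s : seq (option T)) : option (seq T) :=
  match s with
  | [::] => Some [::]
  | Some x :: s' => omap (cons x) (all_some s')
  | None :: _ => None
  end.

(* [None] on terms that are not ground. *)
Fixpoint eval (Sg : signature) (t : term (srt Sg) (sym Sg)) :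
    option (sym Sg) :=
  match t with
  | Var _ => None
  | App f ts => omap (interp f) (all_some (map (@eval Sg) ts))
  end.

Definition valid (Sg : signature) (phi : sterm Sg) : Prop :=
  forall gamma : ssubst Sg, is_subst gamma ->
    (forall x, x \in vars phi -> maps_to_value gamma x) ->
    eval (subst gamma phi) = Some (vtop Sg).

Definition is_lvar (Sg : signature) (rho : srule Sg) (x : srt Sg * nat) : bool :=
  (x \in vars (cond rho)) || (x \in vars (rhs rho)) && (x \notin vars (lhs rho)).

Definition respects (Sg : signature) (sigma : ssubst Sg) (rho : srule Sg) :
    Prop :=
  [/\ forall x, isSome (sigma x) =
        (x \in vars (lhs rho) ++ vars (rhs rho) ++ vars (cond rho)),
      forall x, is_lvar rho x -> maps_to_value sigma x
    & valid (subst sigma (cond rho))].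

(* [f(x_0,...,x_(n-1)) -> x_n [x_n = f(x_0,...,x_(n-1))]] *)
Definition calc_rule (Sg : signature) (f : sym Sg) : srule Sg :=
  let n := size (args f) in
  let l := App f [seq Var x | x <- zip (args f) (iota 0 n)] in
  let y := Var (res f, n) in
  Rule l y (App (eqs (res f)) [:: y; l]).

Definition with_calc (Sg : signature) (R : srule Sg -> Prop) (rho : srule Sg) :
    Prop :=
  R rho \/ exists2 f, is_th f && ~~ is_val f & rho = calc_rule f.

Definition step (Sg : signature) (R : srule Sg -> Prop) (s t : sterm Sg) :
    Prop :=
  is_term s /\
  exists p rho sigma,
    [/\ with_calc R rho, is_subst sigma, respects sigma rho,
        subterm_at s p = Some (subst sigma (lhs rho))
      & t = replace_at s p (subst sigma (rhs rho))].

Record lctrs := Lctrs {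
  lsig : signature;
  lrules : srule lsig -> Prop;
  lrulesP : forall rho, lrules rho -> is_rule rho }.

Definition terminating (R : lctrs) : Prop :=
  ~ exists u : nat -> sterm (lsig R), forall n, step (@lrules R) (u n) (u n.+1).

Definition locally_confluent (R : lctrs) : Prop :=
  forall s t u, step (@lrules R) s t -> step (@lrules R) s u ->
  exists v, clos_refl_trans _ (step (@lrules R)) t v /\
            clos_refl_trans _ (step (@lrules R)) u v.

(** * Finitely presented LCTRSs over linear integer arithmetic *)

Inductive psort := SBool | SInt | SUser of nat.

Definition nat_of_psort (i : psort) : nat :=
  match i with SBool => 0 | SInt => 1 | SUser n => n.+2 end.
Definition psort_of_nat (n : nat) : psort :=
  match n with 0 => SBool | 1 => SInt | n.+2 => SUser n end.
Lemma nat_of_psortK : cancel nat_of_psort psort_of_nat.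
Proof. by case. Qed.
HB.instance Definition _ := Equality.copy psort (can_type nat_of_psortK).

Inductive psym :=
| BoolC of bool | IntC of int
| Not | And | Or | Imp | EqBool | EqInt | Le | Lt | Add | Sub | Opp
| Fn of nat.

(* [decls] lists the argument and result sorts of the term symbols
   [Fn 0, Fn 1, ...]. *)
Record presentation := Presentation {
  decls : seq (seq psort * psort);
  prules : seq (rule psort psym) }.

Definition pargs (D : seq (seq psort * psort)) (f : psym) : seq psort :=
  match f with
  | BoolC _ | IntC _ => [::]
  | Not => [:: SBool]
  | And | Or | Imp | EqBool => [:: SBool; SBool]
  | EqInt | Le | Lt | Add | Sub => [:: SInt; SInt]
  | Opp => [:: SInt]
  | Fn i => (nth ([::], SBool) D i).1
  end.

Definition pres (D : seq (seq psort * psort)) (f : psym) : psort :=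
  match f with
  | BoolC _ | Not | And | Or | Imp | EqBool | EqInt | Le | Lt => SBool
  | IntC _ | Add | Sub | Opp => SInt
  | Fn i => (nth ([::], SBool) D i).2
  end.

Definition pte (D : seq (seq psort * psort)) (f : psym) : bool :=
  if f is Fn i then i < size D else false.

Definition pth (f : psym) : bool := if f is Fn _ then false else true.

Definition pval (f : psym) : bool :=
  match f with BoolC _ | IntC _ => true | _ => false end.

Definition peqs (i : psort) : psym := if i is SBool then EqBool else EqInt.

Definition pinterp (f : psym) (vs : seq psym) : psym :=
  match f, vs with
  | Not, [:: BoolC a] => BoolC (~~ a)
  | And, [:: BoolC a; BoolC b] => BoolC (a && b)
  | Or, [:: BoolC a; BoolC b] => BoolC (a || b)
  | Imp, [:: BoolC a; BoolC b] => BoolC (a ==> b)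
  | EqBool, [:: BoolC a; BoolC b] => BoolC (a == b)
  | EqInt, [:: IntC a; IntC b] => BoolC (a == b)
  | Le, [:: IntC a; IntC b] => BoolC (a <= b)%R
  | Lt, [:: IntC a; IntC b] => BoolC (a < b)%R
  | Add, [:: IntC a; IntC b] => IntC (a + b)%R
  | Sub, [:: IntC a; IntC b] => IntC (a - b)%R
  | Opp, [:: IntC a] => IntC (- a)%R
  | _, _ => f
  end.

Section PresentedSignature.
Variable D : seq (seq psort * psort).

Lemma pth_sort i :
  (exists2 f, pth f & i \in pres D f :: pargs D f) -> i = SBool \/ i = SInt.
Proof.
by case=> f; case: i => [||n]; [left | right | case: f].
Qed.

Lemma pval_inhabited i :
  (exists2 f, pth f & i \in pres D f :: pargs D f) ->
  exists2 v, pval v & pres D v = i.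
Proof.
by case/pth_sort=> ->; [exists (BoolC true) | exists (IntC 0)].
Qed.

Lemma pval_sbool v :
  (pval v /\ pres D v = SBool) <-> (v = BoolC true \/ v = BoolC false).
Proof.
split; last by case=> ->.
by case; case: v => // -[]; [left | right].
Qed.

Lemma pinterp_sort f vs : pth f -> all pval vs -> map (pres D) vs = pargs D f ->
  pval (pinterp f vs) /\ pres D (pinterp f vs) = pres D f.
Proof.
case: f => // _;
  case: vs => [|v [|w [|? ?]]] //; case: v => // ? //; by case: w.
Qed.

Lemma peqs_spec i :
  (exists2 f, pth f & i \in pres D f :: pargs D f) ->
  [/\ pth (peqs i), pargs D (peqs i) = [:: i; i], pres D (peqs i) = SBool &
    forall v w, pval v -> pval w -> pres D v = i -> pres D w = i ->
      (v = w -> pinterp (peqs i) [:: v; w] = BoolC true) /\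
      (v <> w -> pinterp (peqs i) [:: v; w] = BoolC false)].
Proof.
case/pth_sort=> ->; split=> // -[?|?||||||||||||?] [?|?||||||||||||?] //= _ _ _ _;
  split=> [[->]|neq]; rewrite ?eqxx //;
  by congr BoolC; apply/eqP=> eq; apply: neq; rewrite eq.
Qed.

Definition psig : signature.
Proof.
refine (@Signature psort psym (pargs D) (pres D) (pte D) pth pval pinterp
  SBool (BoolC true) (BoolC false) Not And Or Imp peqs
  _ _ pval_inhabited _ _ pinterp_sort pval_sbool _ _ _ _ _ peqs_spec);
  by [case | case=> [?|?||||||||||||?] |].
Defined.

End PresentedSignature.

Definition presented_rules (P : presentation) : srule (psig (decls P)) -> Prop :=
  fun rho => List.In rho (prules P).

Definition wf_presentation (P : presentation) : Prop :=
  forall rho, presented_rules (P := P) rho -> is_rule rho.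

Definition lctrs_of (P : presentation) (wf : wf_presentation P) : lctrs :=
  Lctrs wf.

(** * Algorithms *)

(* The Turing-complete language WHILE of N. D. Jones (Computability and
   Complexity from a Programming Perspective, 1997): imperative programs over
   binary trees with variables [X_0, X_1, ...].  The input is given in [X_0],
   all other variables being initially [Leaf], and the output is the final value
   of [X_0].  Conditionals are definable, and so is the equality test. *)
Inductive tree := Leaf | Node of tree & tree.

Inductive expr :=
| EVar of nat
| ENil
| ECons of expr & expr
| EHd of expr
| ETl of expr.

Inductive cmd :=
| Assign of nat & expr
| Seqc of cmd & cmd
| While of expr & cmd.

Definition store := nat -> tree.

Definition left_of (d : tree) : tree := if d is Node a _ then a else Leaf.
Definition right_of (d : tree) : tree := if d is Node _ b then b else Leaf.

Fixpoint eval_expr (s : store) (e : expr) : tree :=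
  match e with
  | EVar n => s n
  | ENil => Leaf
  | ECons e1 e2 => Node (eval_expr s e1) (eval_expr s e2)
  | EHd e1 => left_of (eval_expr s e1)
  | ETl e1 => right_of (eval_expr s e1)
  end.

Definition update (s : store) (n : nat) (d : tree) : store :=
  fun m => if m == n then d else s m.

Inductive exec : cmd -> store -> store -> Prop :=
| exec_assign n e s : exec (Assign n e) s (update s n (eval_expr s e))
| exec_seq c1 c2 s1 s2 s3 :
    exec c1 s1 s2 -> exec c2 s2 s3 -> exec (Seqc c1 c2) s1 s3
| exec_while_stop e c s : eval_expr s e = Leaf -> exec (While e c) s s
| exec_while_loop e c s1 s2 s3 :
    eval_expr s1 e <> Leaf -> exec c s1 s2 -> exec (While e c) s2 s3 ->
    exec (While e c) s1 s3.

Definition outputs (p : cmd) (input output : tree) : Prop :=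
  exists2 s, exec p (update (fun=> Leaf) 0 input) s & s 0 = output.

(** * Presentations as data *)

Definition enc_bool (b : bool) : tree := if b then Node Leaf Leaf else Leaf.

Fixpoint enc_nat (n : nat) : tree :=
  if n is n'.+1 then Node Leaf (enc_nat n') else Leaf.

(* [Negz n] is [- n.+1]. *)
Definition enc_int (z : int) : tree :=
  match z with
  | Posz n => Node (enc_bool true) (enc_nat n)
  | Negz n => Node (enc_bool false) (enc_nat n)
  end.

Fixpoint enc_seq (T : Type) (enc : T -> tree) (s : seq T) : tree :=
  if s is x :: s' then Node (enc x) (enc_seq enc s') else Leaf.

Definition enc_sort (i : psort) : tree := enc_nat (nat_of_psort i).

Definition enc_sym (f : psym) : tree :=
  match f with
  | BoolC b => Node (enc_nat 0) (enc_bool b)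
  | IntC z => Node (enc_nat 1) (enc_int z)
  | Not => Node (enc_nat 2) Leaf
  | And => Node (enc_nat 3) Leaf
  | Or => Node (enc_nat 4) Leaf
  | Imp => Node (enc_nat 5) Leaf
  | EqBool => Node (enc_nat 6) Leaf
  | EqInt => Node (enc_nat 7) Leaf
  | Le => Node (enc_nat 8) Leaf
  | Lt => Node (enc_nat 9) Leaf
  | Add => Node (enc_nat 10) Leaf
  | Sub => Node (enc_nat 11) Leaf
  | Opp => Node (enc_nat 12) Leaf
  | Fn n => Node (enc_nat 13) (enc_nat n)
  end.

Fixpoint enc_term (t : term psort psym) : tree :=
  match t with
  | Var (i, n) => Node (enc_bool false) (Node (enc_sort i) (enc_nat n))
  | App f ts => Node (enc_bool true) (Node (enc_sym f) (enc_seq enc_term ts))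
  end.

Definition enc_rule (rho : rule psort psym) : tree :=
  Node (enc_term (lhs rho)) (Node (enc_term (rhs rho)) (enc_term (cond rho))).

Definition enc_decl (d : seq psort * psort) : tree :=
  Node (enc_seq enc_sort d.1) (enc_sort d.2).

Definition enc_presentation (P : presentation) : tree :=
  Node (enc_seq enc_decl (decls P)) (enc_seq enc_rule (prules P)).

(* Main.v *)
Require Import Defs.
From mathcomp Require Import all_boot.
From mathcomp Require Import all_order ssralg ssrnum ssrint.
From Stdlib Require List.
From Stdlib Require Import Relations.

(** Trees are represented by terms over [leaf] and [node], and a machine on
    trees given by orthogonal patterns [L -> R] is simulated by the rules
    [sim(n,L) -> sim(m,R) [0 <= m /\ n = m + 1]]; the fuel [n] enforces
    termination.  Running out of fuel, or halting with the answer [Leaf], leads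
    to [idle], while halting with any other answer is a normal form.  If the
    start rules are [sim(n,leaf) -> sim(m,c)] and [sim(n,leaf) -> idle], this
    LCTRS is locally confluent when the run from [c] halts with [Leaf], and is
    not when it halts with another answer.

    From a decision procedure [p] one obtains a machine program [x] which quotes
    its own code, builds the presentation of the LCTRS in which the initial
    configuration [c] runs [x] on [x], and runs [p] on it.  Its answer is wrong
    for this LCTRS: [true] makes the machine get stuck, and [false] makes it
    reach [idle].  Only the simulation of halting WHILE runs is needed, and
    quotation is an instruction of the machine. *)

Set Implicit Arguments.
Unset Strict Implicit.
Unset Printing Implicit Defensive.

(** * Contextual steps *)

Section Terms.
Variables S F : Type.
Implicit Types t : term S F.

Lemma term_nested_ind (P : term S F -> Prop) :
  (forall x, P (Var x)) ->
  (forall f ts, List.Forall P ts -> P (App f ts)) ->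
  forall t, P t.
Proof.
move=> PVar PApp; fix IH 1 => -[x|f ts]; first exact: PVar.
apply: PApp; elim: ts => [|t ts IHts]; first exact: List.Forall_nil.
by apply: List.Forall_cons IHts; apply: IH.
Qed.

Fixpoint tsize t : nat :=
  if t is App _ ts then (sumn (map tsize ts)).+1 else 1.

(** Replaces explicit positions by an inductive context closure, so that peaks can be analysed by
    induction instead of by comparing positions. *)
Inductive ctx (T : term S F -> term S F -> Prop) :
    term S F -> term S F -> Prop :=
| ctx_top s t : T s t -> ctx T s t
| ctx_arg f a t t' b :
    ctx T t t' -> ctx T (App f (a ++ t :: b)) (App f (a ++ t' :: b)).

Definition joinable (T : term S F -> term S F -> Prop) t u : Prop :=
  exists v, clos_refl_trans _ (ctx T) t v /\ clos_refl_trans _ (ctx T) u v.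

Lemma ctx_inv (T : term S F -> term S F -> Prop) s u : ctx T s u ->
  T s u \/ exists f a v v' b,
    [/\ s = App f (a ++ v :: b), u = App f (a ++ v' :: b) & ctx T v v'].
Proof.
by case=> {s u} [s u|f a v v' b vv']; [left|right; exists f, a, v, v', b].
Qed.

Lemma rtc_ctx_arg T f a t t' b : clos_refl_trans _ (ctx T) t t' ->
  clos_refl_trans _ (ctx T) (App f (a ++ t :: b)) (App f (a ++ t' :: b)).
Proof.
elim=> {t t'} [t u tu|t|t u v _ tu _ uv].
- exact/rt_step/ctx_arg.
- exact: rt_refl.
- exact: rt_trans tu uv.
Qed.

Lemma cat_cons_eq (T : Type) (a a' b b' : seq T) (x x' : T) :
  a ++ x :: b = a' ++ x' :: b' ->
  [\/ [/\ a = a', x = x' & b = b'],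
      exists c, a' = a ++ x :: c /\ b = c ++ x' :: b'
    | exists c, a = a' ++ x' :: c /\ b' = c ++ x :: b].
Proof.
elim: a a' => [|y a IH] [|y' a'] /= [].
- by move=> -> ->; constructor 1.
- by move=> -> ->; constructor 2; exists a'.
- by move=> <- <-; constructor 3; exists a.
- move=> -> /IH[[-> -> ->]|[c [-> ->]]|[c [-> ->]]].
  + by constructor 1.
  + by constructor 2; exists c.
  + by constructor 3; exists c.
Qed.

(* Redexes whose arguments are normal forms never overlap properly, so only
   peaks at equal or parallel positions remain. *)
Lemma innermost_peak_joinable T (W : term S F -> Prop) :
  (forall f a t b, W (App f (a ++ t :: b)) -> W t) ->
  (forall f a t b u v, W (App f (a ++ t :: b)) ->
     T (App f (a ++ t :: b)) u -> ~ ctx T t v) ->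
  (forall s t u, W s -> T s t -> T s u -> joinable T t u) ->
  forall s t u, W s -> ctx T s t -> ctx T s u -> joinable T t u.
Proof.
move=> Warg nf peak s t u Ws st; elim: st u Ws => {s t}.
  move=> s t st u Ws /ctx_inv[su|[f [a [v [v' [b [E _ vv']]]]]]].
    exact: peak st su.
  by subst s; case: (nf _ _ _ _ _ _ Ws st vv').
move=> f a v v' b vv' IH u Ws /ctx_inv[su|[f' [a' [w [w' [b' [E -> ww']]]]]]].
  by case: (nf _ _ _ _ _ _ Ws su vv').
have [Ef E'] : f = f' /\ a ++ v :: b = a' ++ w :: b' by case: E.
(* Both steps are below the root. In the same argument the induction hypothesis joins them; in
   different arguments each result is closed by the other step. *)
subst f'; case: (cat_cons_eq E') => [[Ea Ev Eb]|[c [E1 E2]]|[c [E1 E2]]].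
- subst w a' b'; have [x [v'x w'x]] := IH _ (Warg _ _ _ _ Ws) ww'.
  by exists (App f (a ++ x :: b)); split; apply: rtc_ctx_arg.
- subst a' b; exists (App f (a ++ v' :: c ++ w' :: b')); split.
    rewrite -!cat_cons !catA; apply: rt_step; exact: ctx_arg.
  by rewrite -catA /=; apply: rt_step; apply: ctx_arg.
- subst a b'; exists (App f (a' ++ w' :: c ++ v' :: b)); split.
    by rewrite -catA /=; apply: rt_step; apply: ctx_arg.
  by rewrite -!cat_cons !catA; apply: rt_step; apply: ctx_arg.
Qed.

End Terms.

(** [respects] fixes the domain of a substitution to the variables of the rule. This allows working
    with total assignments and cutting them down at the end. *)
Lemma subst_restrict (S : eqType) F (sigma : S * nat -> term S F)
    (V : seq (S * nat)) t :
  {subset vars t <= V} ->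
  subst (fun x => if x \in V then Some (sigma x) else None) t =
  subst (fun x => Some (sigma x)) t.
Proof.
elim/term_nested_ind: t => [x|f ts IH] sub /=.
  by rewrite sub ?mem_head.
congr App; elim: IH sub => {ts} //= t ts IHt _ IHts sub; congr cons.
  by apply: IHt => x xt; apply: sub; rewrite /= mem_cat xt.
by apply: IHts => x xts; apply: sub; rewrite /= mem_cat xts orbT.
Qed.

(** * Root steps, preservation of sorts, and the rewrite relation as a context closure *)

Section Steps.
Variables (Sg : signature) (R : srule Sg -> Prop).
Hypothesis ruleR : forall rho, R rho -> is_rule rho.
Implicit Types s t u : sterm Sg.

Definition top_step s t : Prop :=
  exists rho sigma, [/\ with_calc R rho, is_subst sigma, respects sigma rho,
    s = subst sigma (lhs rho) & t = subst sigma (rhs rho)].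

Lemma has_sort_subst (sigma : ssubst Sg) t i : is_subst sigma ->
  has_sort t i -> has_sort (subst sigma t) i.
Proof.
move=> sortS; elim/term_nested_ind: t i => [x|f ts IH] i /=.
  by move=> /eqP <-; case E: (sigma x) => [t|] /=; [exact: sortS|].
case/and3P=> -> -> /=; elim: IH (args f) => {ts} [|t ts IHt _ IHts] [|j js] //=.
by case/andP=> /IHt-> /IHts.
Qed.

Lemma has_sort_inj t i j : has_sort t i -> has_sort t j -> i = j.
Proof.
by case: t => [x|f ts] /= => [/eqP<- /eqP<-|/and3P[_ /eqP<- _] /and3P[_ /eqP<- _]].
Qed.

Lemma all2_cat_cons (A B : Type) (r : A -> B -> bool) a x b js :
  all2 r (a ++ x :: b) js -> exists j, [/\ List.In j js, r x j &
    forall y, r y j -> all2 r (a ++ y :: b) js].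
Proof.
elim: a js => [|z a IH] [|j js] //= /andP[rx].
  by move=> rb; exists j; split=> [||y ->] //; left.
by case/IH=> k [jsk rxk H]; exists k; split=> [||y /H->]; rewrite ?rx //; right.
Qed.

Lemma has_sort_arg f a t b i : has_sort (App f (a ++ t :: b) : sterm Sg) i ->
  exists j, [/\ List.In j (args f), has_sort t j &
    forall u, has_sort u j -> has_sort (App f (a ++ u :: b) : sterm Sg) i].
Proof.
case/and3P=> H1 H2 H3; have [j [fj tj H]] := all2_cat_cons H3.
by exists j; split=> // u /H /= ->; rewrite H1 H2.
Qed.

Lemma top_step_sort s t i : top_step s t -> has_sort s i -> has_sort t i.
Proof.
case=> rho [sigma [Rrho sortS _ -> ->]] si.
case: Rrho => [/ruleR[[j /andP[lj rj]] _ _]|[f fth Erho]].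
  rewrite (has_sort_inj si (has_sort_subst sortS lj)).
  exact: has_sort_subst rj.
(* A calculation rule has a variable of sort [res f] as right-hand side, and [sigma] preserves
   sorts. *)
subst rho; move: si => /= /and3P[_ /eqP<- _].
case E: (sigma _) => [u|] //=.
exact: sortS E.
Qed.

Lemma ctx_sort s t i : ctx top_step s t -> has_sort s i -> has_sort t i.
Proof.
move=> st; elim: st i => {s t} [s t st|f a t t' b _ IH] i.
  exact: top_step_sort st.
by case/has_sort_arg=> j [_ /IH tj]; apply.
Qed.

Lemma step_ctx s t : step R s t -> ctx top_step s t.
Proof.
case=> _ [p [rho [sigma [Rrho sortS resp]]]].
have top : ctx top_step (subst sigma (lhs rho)) (subst sigma (rhs rho)).
  by apply: ctx_top; exists rho, sigma.
elim: p s t => [|i p IH] s t /=; first by case=> -> ->.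
case: s => [//|f ts]; case E: (onth ts i) => [u|//] up ->.
suff [a [b [-> ->]]]: exists a b, ts = a ++ u :: b /\
    forall v, set_nth u ts i v = a ++ v :: b.
  exact: ctx_arg (IH _ _ up erefl).
elim: ts i E => [|w ts IHts] [|i] //= E; first by case: E => ->; exists [::], ts.
have [a [b [-> H]]] := IHts _ E.
by exists (w :: a), b; split=> // v; rewrite H.
Qed.

Lemma ctx_step s t : is_term s -> ctx top_step s t -> step R s t.
Proof.
move=> ts st; split=> //.
elim: st => {s t ts} [s t [rho [sigma [Rrho sortS resp -> ->]]]|f a t t' b _].
  by exists [::], rho, sigma; split.
case=> p [rho [sigma [Rrho sortS resp tp ->]]].
have E : onth (a ++ t :: b) (size a) = Some t by elim: a.
exists (size a :: p), rho, sigma; split=> //=; rewrite E //.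
by congr App; elim: a {E} => //= x a <-.
Qed.

(** [step] demands a well-sorted source; sort preservation provides it along the whole sequence. *)
Lemma rtc_ctx_step s t : is_term s ->
  clos_refl_trans _ (ctx top_step) s t -> clos_refl_trans _ (step R) s t.
Proof.
move=> [i si] st; suff: has_sort t i /\ clos_refl_trans _ (step R) s t by case.
elim: st si => {s t} [s t st|s|s t u _ IH1 _ IH2] si.
- by split; [exact: ctx_sort st si|apply: rt_step; apply: ctx_step => //; exists i].
- by split=> //; apply: rt_refl.
- have [ti st] := IH1 si; have [ui tu] := IH2 ti.
  by split=> //; apply: rt_trans st tu.
Qed.

Lemma rtc_step_ctx s t :
  clos_refl_trans _ (step R) s t -> clos_refl_trans _ (ctx top_step) s t.
Proof.
elim=> {s t} [s t /step_ctx st|s|s t u _ st _ tu].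
- exact: rt_step.
- exact: rt_refl.
- exact: rt_trans st tu.
Qed.

End Steps.

(** * Simulation of a tree rewriting machine *)

Local Notation tm := (term psort psym).

Definition data : psort := SUser 0.
Definition result : psort := SUser 1.

(** The two user sorts confine rewriting: no symbol takes an argument of sort [result], so a
    well-sorted term contains [sim] at most at the root, and terms of sort [data] contain no
    redex. *)
Definition sim_decls : seq (seq psort * psort) :=
  [:: ([::], data); ([:: data; data], data); ([:: SInt; data], result);
      ([::], result)].
Definition leaf : tm := App (Fn 0) [::].
Definition node (a b : tm) : tm := App (Fn 1) [:: a; b].
Definition sim (e d : tm) : tm := App (Fn 2) [:: e; d].
Definition idle : tm := App (Fn 3) [::].
Definition num (z : int) : tm := App (IntC z) [::].

Local Notation sg := (psig sim_decls).
Local Notation Vn := (Var (SInt, 0) : tm).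
Local Notation Vm := (Var (SInt, 1) : tm).

Inductive pat := PV of nat | PL | PN of pat & pat.

Fixpoint papp (tau : nat -> tm) (p : pat) : tm :=
  match p with
  | PV i => tau i
  | PL => leaf
  | PN p q => node (papp tau p) (papp tau q)
  end.

Definition pterm : pat -> tm := papp (fun i => Var (data, i)).

Fixpoint pvars (p : pat) : seq nat :=
  match p with
  | PV i => [:: i]
  | PL => [::]
  | PN p q => pvars p ++ pvars q
  end.

(** A conflict of constructors at a common position. It excludes common instances even under
    independent substitutions, and is checked by computation for a concrete machine. *)
Fixpoint clash (p q : pat) : bool :=
  match p, q with
  | PL, PN _ _ | PN _ _, PL => true
  | PN p1 p2, PN q1 q2 => clash p1 q1 || clash p2 q2
  | _, _ => false
  end.

Lemma clashP p q tau1 tau2 : clash p q -> papp tau1 p <> papp tau2 q.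
Proof.
elim: p q => [i||p1 IH1 p2 IH2] [j||q1 q2] //= /orP[/IH1|/IH2] H [E1 E2];
  exact: H.
Qed.

Lemma eq_papp p tau1 tau2 : {in pvars p, tau1 =1 tau2} ->
  papp tau1 p = papp tau2 p.
Proof.
elim: p => [i||p IHp q IHq] //= H; first exact/H/mem_head.
by rewrite IHp ?IHq // => i ip; apply: H; rewrite mem_cat ip ?orbT.
Qed.

Lemma papp_inj p tau1 tau2 : papp tau1 p = papp tau2 p ->
  {in pvars p, tau1 =1 tau2}.
Proof.
elim: p => [i||p IHp q IHq] //=; first by move=> E j /[1!inE] /eqP->.
by case=> /IHp E1 /IHq E2 i; rewrite mem_cat => /orP[/E1|/E2].
Qed.

Lemma subst_papp sigma tau p :
  subst sigma (papp tau p) = papp (subst sigma \o tau) p.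
Proof. by elim: p => //= p -> q ->. Qed.

Lemma papp_sort (tau : nat -> tm) p :
  (forall i, @has_sort sg (tau i) data) -> @has_sort sg (papp tau p) data.
Proof. by move=> H; elim: p => //= p -> q ->. Qed.

Lemma vars_pterm p x : (x \in vars (pterm p)) = (x.1 == data) && (x.2 \in pvars p).
Proof.
elim: p => [i||p IHp q IHq] /=.
- by rewrite !inE; case: x.
- by rewrite andbF.
- by rewrite cats0 !mem_cat IHp IHq -andb_orr.
Qed.

(* [n = m + 1 /\ 0 <= m] forces [n] to be instantiated by a positive value and
   determines [m], so that no calculation step is needed between two steps. *)
Definition tick : tm :=
  App And [:: App Le [:: num 0; Vm]; App EqInt [:: Vn; App Add [:: Vm; num 1]]].

Definition run_rule (r : pat * pat) : rule psort psym :=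
  Rule (sim Vn (pterm r.1)) (sim Vm (pterm r.2)) tick.
Definition halt_rule (L : pat) : rule psort psym :=
  Rule (sim Vn (pterm L)) idle tick.
Definition timeout_rule : rule psort psym :=
  Rule (sim Vn (pterm (PV 0))) idle (App EqInt [:: Vn; num 0]).

Section Simulator.
Variables (start : pat) (M : seq (pat * pat)) (H : seq pat).

Definition sim_rules : seq (rule psort psym) :=
  run_rule (PL, start) ::
    map run_rule M ++ map halt_rule (PL :: H) ++ [:: timeout_rule].

Definition sim_presentation : presentation := Presentation sim_decls sim_rules.

(** The root steps from [sim (num k) d] with their constraints solved. [root_start] and [root_skip]
    are the intended conflict at [leaf]. *)
Inductive root : nat -> tm -> tm -> Prop :=
| root_run k r tau : List.In r M ->
    root k.+1 (papp tau r.1) (sim (num k) (papp tau r.2))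
| root_start k : root k.+1 leaf (sim (num k) (pterm start))
| root_skip k : root k.+1 leaf idle
| root_halt k L tau : List.In L H -> root k.+1 (papp tau L) idle
| root_timeout d : root 0 d idle.

(** Requiring a non-empty argument list keeps values from rewriting to themselves. *)
Definition calc (s t : tm) : Prop :=
  exists f vs v, [/\ pth f, all pval vs, vs <> [::],
    s = App f [seq App v [::] | v <- vs] & t = App v [::] /\ v = pinterp f vs].

Hypothesis start_closed : pvars start = [::].
Hypothesis M_vars : forall r, List.In r M -> {subset pvars r.2 <= pvars r.1}.

Local Notation top := (top_step (presented_rules (P := sim_presentation))).

Lemma In_cat T (x : T) a b : List.In x (a ++ b) <-> List.In x a \/ List.In x b.
Proof. exact: List.in_app_iff. Qed.

Lemma In_map T U (f : T -> U) y s :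
  List.In y (map f s) <-> exists x, f x = y /\ List.In x s.
Proof. exact: List.in_map_iff. Qed.

Lemma In_sim_rules rho : List.In rho sim_rules <->
  [\/ rho = run_rule (PL, start), exists2 r, List.In r M & rho = run_rule r,
      exists2 L, List.In L (PL :: H) & rho = halt_rule L | rho = timeout_rule].
Proof.
rewrite /sim_rules -(cat1s (run_rule _)) !In_cat !In_map.
split.
  case=> [[<-|//]|]; first by constructor 1.
  case=> [[r [<- ?]]|]; first by constructor 2; exists r.
  case=> [[L [<- ?]]|]; first by constructor 3; exists L.
  by case=> [<-|//]; constructor 4.
case=> [->|[r ? ->]|[L ? ->]|->].
- by left; left.
- by right; left; exists r.
- by right; right; left; exists L.
- by right; right; right; left.
Qed.

Lemma sim_wf : wf_presentation sim_presentation.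
Proof.
have Hsort p : @has_sort sg (pterm p) data by apply: papp_sort.
move=> rho /In_sim_rules[->|[r _ ->]|[L _ ->]|->]; split=> //=.
all: try by exists result; rewrite /= ?Hsort.
all: by exists (Fn 2); eexists.
Qed.

(** * Inversion of root steps *)

Lemma value_of_sort (sigma : ssubst sg) x : is_subst sigma ->
  maps_to_value sigma x ->
  exists v, [/\ sigma x = Some (App v [::]), pval v & pres sim_decls v == x.1].
Proof.
move=> sortS [v vv E]; exists v; split=> //.
by move: (sortS _ _ E) => /= /and3P[].
Qed.

Lemma int_value (sigma : ssubst sg) i : is_subst sigma ->
  maps_to_value sigma (SInt, i) -> exists z, sigma (SInt, i) = Some (num z).
Proof.
by move=> sortS /(value_of_sort sortS)[v [-> ]]; case: v => // z _ _; exists z.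
Qed.

Lemma bool_value (sigma : ssubst sg) i : is_subst sigma ->
  maps_to_value sigma (SBool, i) ->
  exists b, sigma (SBool, i) = Some (App (BoolC b) [::]).
Proof.
by move=> sortS /(value_of_sort sortS)[v [-> ]]; case: v => // z _ _; exists z.
Qed.

(** A constraint whose variables have all been mapped to values is closed, so the empty substitution
    already shows what its validity means. *)
Lemma valid_closed (phi : sterm sg) : vars phi = [::] -> valid phi ->
  eval (subst (fun=> None) phi) = Some (vtop sg).
Proof. by move=> E; apply=> // x; rewrite E. Qed.

(** Both variables occur in the constraint and are thus mapped to integers; [0 <= m] makes the
    second one a natural number, and the equation makes the first one its successor. *)
Lemma tick_inv (sigma : ssubst sg) rho : is_subst sigma ->
  respects sigma rho -> cond rho = tick ->
  exists k : nat, sigma (SInt, 0) = Some (num k.+1) /\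
                  sigma (SInt, 1) = Some (num k).
Proof.
move=> sortS [_ lv val] E; rewrite E in val.
have [a Ea] : exists z, sigma (SInt, 0) = Some (num z).
  by apply: int_value => //; apply: lv; rewrite /is_lvar E.
have [b Eb] : exists z, sigma (SInt, 1) = Some (num z).
  by apply: int_value => //; apply: lv; rewrite /is_lvar E.
have := valid_closed _ val; rewrite /= Ea Eb /= => /(_ erefl) [].
case: b Eb => //= b _ /eqP->; exists b; split=> //.
by rewrite -addn1.
Qed.

Lemma calcI f vs : pth f -> all pval vs -> vs <> [::] ->
  calc (App f [seq App v [::] | v <- vs]) (App (pinterp f vs) [::]).
Proof. by exists f, vs, (pinterp f vs). Qed.

(** All variables of a calculation rule occur in its constraint, hence are mapped to values, and the
    constraint forces the result variable to be the computed value. *)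
Lemma calc_inv f (sigma : ssubst sg) : is_subst sigma -> pth f && ~~ pval f ->
  respects sigma (calc_rule (Sg := sg) f) ->
  calc (subst sigma (lhs (calc_rule (Sg := sg) f)))
    (subst sigma (rhs (calc_rule (Sg := sg) f))).
Proof.
move=> sortS fcalc [_ lv val].
have lvb i : (SBool, i) \in vars (cond (calc_rule (Sg := sg) f)) ->
    exists b, sigma (SBool, i) = Some (App (BoolC b) [::]).
  by move=> fi; apply: bool_value => //; apply: lv; rewrite /is_lvar fi.
have lvi i : (SInt, i) \in vars (cond (calc_rule (Sg := sg) f)) ->
    exists z, sigma (SInt, i) = Some (num z).
  by move=> fi; apply: int_value => //; apply: lv; rewrite /is_lvar fi.
case: f fcalc lv val lvb lvi => //= _ lv val lvb lvi.
all: first [have [a E0] := lvb 0 isT | have [a E0] := lvi 0 isT].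
all: first [have [b E1] := lvb 1 isT | have [b E1] := lvi 1 isT].
(* The result variable has the arity as its index, so index 2 exists for the binary symbols only. *)
all: try first [have [c E2] := lvb 2 isT | have [c E2] := lvi 2 isT].
all: move/(valid_closed _): val; rewrite /= E0 E1 ?E2 /=.
all: case/(_ erefl) => /eqP->.
all: first [exact: (calcI (vs := [:: BoolC _])) | exact: (calcI (vs := [:: IntC _]))
  | exact: (calcI (vs := [:: BoolC _; BoolC _]))
  | exact: (calcI (vs := [:: IntC _; IntC _]))].
Qed.

Lemma top_inv s t : top s t ->
  (exists k d, s = sim (num (Posz k)) d /\ root k d t) \/ calc s t.
Proof.
have tick_sub rho (sigma : ssubst sg) p : is_subst sigma ->
    respects sigma rho -> cond rho = tick -> exists k : nat,
      subst sigma (sim Vn p) = sim (num k.+1) (subst sigma p) /\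
      forall q, subst sigma (sim Vm q) = sim (num k) (subst sigma q).
  move=> sortS /tick_inv-/(_ sortS) E /E[k [En Em]].
  by exists k; rewrite /= En Em.
case=> rho [sigma [Rrho sortS resp -> ->]].
case: Rrho => [/In_sim_rules|[f fcalc Erho]]; last first.
  by right; subst rho; apply: calc_inv.
case=> [E|[r Mr E]|[L HL E]|E]; left; subst rho.
- have [k [-> Em]] := tick_sub _ _ (pterm PL) sortS resp erefl.
  exists k.+1, leaf; split=> //; rewrite Em subst_papp.
  (* The initial configuration is closed, so no substitution changes it. *)
  rewrite (_ : papp _ _ = pterm start); first exact: root_start.
  by apply: eq_papp => i; rewrite start_closed.
- have [k [-> Em]] := tick_sub _ _ (pterm r.1) sortS resp erefl.
  by eexists _, _; split=> //; rewrite Em !subst_papp; apply: root_run.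
- have [k [-> Em]] := tick_sub _ _ (pterm L) sortS resp erefl.
  case: HL => [<-|HL]; first by exists k.+1, leaf; split=> //; apply: root_skip.
  by eexists _, _; split=> //; rewrite subst_papp; apply: root_halt.
- have [_ lv val] := resp.
  have [|z Ez] := int_value (i := 0) sortS; first exact: lv.
  have := valid_closed _ val; rewrite /= Ez /= => /(_ erefl) [] /eqP E; subst z.
  by eexists 0, _; split=> //; apply: root_timeout.
Qed.

(** * Construction of root steps *)

Definition assign (n : nat) (m : int) (tau : nat -> tm) (x : psort * nat) : tm :=
  match x with
  | (SInt, 0) => num n
  | (SInt, 1) => num m
  | (SUser 0, i) => tau i
  | _ => Var x
  end.

Lemma top_intro rho n m tau (sigma := fun x => Some (assign n m tau x)) :
  List.In rho sim_rules -> (forall i, @has_sort sg (tau i) data) ->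
  (forall x, @is_lvar sg rho x -> x \in [:: (SInt, 0); (SInt, 1)]) ->
  valid (Sg := sg) (subst sigma (cond rho)) ->
  top (subst sigma (lhs rho)) (subst sigma (rhs rho)).
Proof.
move=> Hrho sortT lv val.
pose V := vars (lhs rho) ++ vars (rhs rho) ++ vars (cond rho).
have E t : {subset vars t <= V} ->
    subst (fun x => if x \in V then Some (assign n m tau x) else None) t =
    subst sigma t by exact: subst_restrict.
exists rho, (fun x => if x \in V then Some (assign n m tau x) else None).
split; first by left.
- move=> x t; case: ifP => // _ [<-].
  by case: x => -[||[|?]] [|[|i]] /=; rewrite ?eqxx ?sortT.
- split=> [x|x lvx|]; first by rewrite /V; case: ifP.
    have xV : x \in V.
      by rewrite /V !mem_cat; case/orP: lvx => [|/andP[]] ->; rewrite ?orbT.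
    rewrite /maps_to_value xV.
    by move: (lv x lvx); rewrite !inE => /orP[] /eqP->;
      [exists (IntC n)|exists (IntC m)].
  by rewrite E // => x xc; rewrite /V !mem_cat xc !orbT.
- by rewrite E // => x xc; rewrite /V !mem_cat xc.
- by rewrite E // => x xc; rewrite /V !mem_cat xc !orbT.
Qed.

Lemma sub_papp n m tau p :
  subst (fun x => Some (assign n m tau x)) (pterm p) = papp tau p.
Proof. by rewrite subst_papp; apply: eq_papp. Qed.

Lemma tick_valid (k : nat) tau :
  valid (Sg := sg) (subst (fun x => Some (assign k.+1 k tau x)) tick).
Proof.
move=> gamma _ _; suff /= -> : Posz k.+1 == (Posz k + 1)%R by [].
by rewrite -addn1.
Qed.

(** The [data] variables of the right-hand side also occur on the left, so they need not be mapped
    to values. *)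
Lemma tick_lvar L t c x : {subset vars t <= (SInt, 1) :: vars (pterm L)} ->
  {subset vars c <= [:: (SInt, 0); (SInt, 1)]} ->
  @is_lvar sg (Rule (sim Vn (pterm L)) t c) x ->
  x \in [:: (SInt, 0); (SInt, 1)].
Proof.
move=> sub subc /orP[/subc //|/andP[/sub]] /=; rewrite cats0 !inE.
by case/orP=> [/eqP->//|->]; rewrite orbT.
Qed.

Lemma run_top k r tau : List.In r M -> (forall i, @has_sort sg (tau i) data) ->
  top (sim (num (Posz k.+1)) (papp tau r.1)) (sim (num (Posz k)) (papp tau r.2)).
Proof.
move=> Mr sortT; rewrite -!(sub_papp k.+1 k).
apply: (top_intro (rho := run_rule r)) => //; last exact: tick_valid.
  by apply/In_sim_rules; constructor 2; exists r.
move=> x; apply: tick_lvar; last exact/allP.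
move=> y /=; rewrite cats0 !inE !vars_pterm => /orP[->//|/andP[->]].
by move=> yr; rewrite (M_vars Mr yr) orbT.
Qed.

Lemma start_top k : top (sim (num (Posz k.+1)) leaf) (sim (num (Posz k)) (pterm start)).
Proof.
have sortT i : @has_sort sg ((fun=> leaf) i) data by [].
have -> : pterm start = papp (fun=> leaf) start.
  by apply: eq_papp => i; rewrite start_closed.
rewrite -[leaf in X in top X]/(papp (fun=> leaf) PL) -!(sub_papp k.+1 k).
apply: (top_intro (rho := run_rule (PL, start))) => //; last exact: tick_valid.
  by apply/In_sim_rules; constructor 1.
move=> x; apply: tick_lvar; last exact/allP.
by move=> y /=; rewrite cats0 !inE !vars_pterm start_closed andbF orbF => ->.
Qed.

Lemma halt_top k L tau : List.In L (PL :: H) ->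
  (forall i, @has_sort sg (tau i) data) ->
  top (sim (num (Posz k.+1)) (papp tau L)) idle.
Proof.
move=> HL sortT; rewrite -!(sub_papp k.+1 k).
apply: (top_intro (rho := halt_rule L)) => //; last exact: tick_valid.
  by apply/In_sim_rules; constructor 3; exists L.
by move=> x; apply: tick_lvar; last exact/allP.
Qed.

Lemma timeout_top d : @has_sort sg d data -> top (sim (num 0) d) idle.
Proof.
move=> sortd.
apply: (top_intro (rho := timeout_rule) (n := 0) (m := 0) (tau := fun=> d)) => //.
  by apply/In_sim_rules; constructor 4.
by move=> x; apply: tick_lvar; last exact/allP.
Qed.

(** * Normal forms *)

Local Notation "s ~> t" := (ctx top s t) (at level 70).
Local Notation "s ~>* t" := (clos_refl_trans _ (ctx top) s t) (at level 70).

Lemma args_of_data f j : @is_te sg f || @is_th sg f ->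
  @res sg f = data -> List.In j (@args sg f) -> j = data.
Proof. by case: f => // -[|[|[|[|n]]]] //= _ _ [|[|[]]]. Qed.

Lemma args_neq_result f j : @is_te sg f || @is_th sg f ->
  List.In j (@args sg f) -> j <> result.
Proof.
case: f => [b|z||||||||||||[|[|[|[|n]]]]] //= _;
  by case=> [<-|] //; do ?case=> [<-|] //.
Qed.

(** Redexes have sort [result] or a theory sort, while all arguments inside a term of sort [data]
    have sort [data] again. *)
Lemma data_nf (s : sterm sg) t : has_sort s data -> ~ s ~> t.
Proof.
move=> + st; elim: st => {s t} [s t /top_inv[[k [d [-> _]]]|]|f a t t' b _ IH] //.
  by case=> f [vs [v [fth _ _ -> _]]] /= /and3P[_]; case: f fth.
move=> sd; have [j [fj tj _]] := has_sort_arg sd.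
move: sd => /= /and3P[ff /eqP fd _].
by rewrite (args_of_data ff fd fj) in tj; apply: IH.
Qed.

Lemma const_nf v t : pval v -> ~ App v [::] ~> t.
Proof.
move=> vv /ctx_inv[/top_inv[[k [d [] ]]|]|].
- by case: v vv.
- by case=> f [[|w vs] [w' [_ _ //]]] _ [].
- by case=> f [[|x a] [u [u' [b []]]]].
Qed.

(** The arguments of a [sim] redex are a numeral and a term of sort [data], and those of a
    calculation redex are values. This is the innermost condition of [innermost_peak_joinable]. *)
Lemma root_args_nf f a t b u v : is_term (App f (a ++ t :: b) : sterm sg) ->
  top (App f (a ++ t :: b)) u -> ~ t ~> v.
Proof.
case=> i si /top_inv[[k [d [E _]]]|].
  have Ef : f = Fn 2 by case: E.
  have {}E : a ++ t :: b = [:: num k; d] by case: E.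
  case: a E si => [|x [|y a]] [] E1.
  - by move=> _ _; subst t; apply: const_nf.
  - by move=> E2 _; subst f t x => /and3P[_ _ /and3P[_ sd _]]; apply: data_nf.
  - by case: a.
case=> g [vs [w [_ vvs _ [_ E] _]]].
have : List.In t [seq App v [::] | v <- vs] by rewrite -E In_cat; right; left.
case/In_map=> x [<- xvs]; apply: const_nf.
by elim: vs vvs xvs {E} => //= y vs IH /andP[yv /IH{}IH] [<-|].
Qed.

Lemma top_rulesP rho : presented_rules (P := sim_presentation) rho ->
  is_rule rho.
Proof. exact: sim_wf. Qed.

Lemma ctx_sim k d t : @has_sort sg d data -> sim (num (Posz k)) d ~> t ->
  root k d t.
Proof.
move=> sd /ctx_inv[/top_inv[[k' [d' [[Ek ->]]]]|]|].
- by rewrite Ek.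
- by case=> f [vs [w [fth _ _ [Ef _] _]]]; rewrite -Ef in fth.
- case=> f [a [v [v' [b [E _]]]]].
  have {}E : a ++ v :: b = [:: num k; d] by case: E.
  case: a E => [|x [|y a]] [] E1.
  + by move=> _ vv'; rewrite E1 in vv'; case: (const_nf _ vv').
  + by move=> E2 _ vv'; rewrite E2 in vv'; case: (data_nf sd vv').
  + by case: a.
Qed.

Lemma idle_nf t : ~ idle ~> t.
Proof.
move=> /ctx_inv[/top_inv[[k [d []]]|]|] //.
- by case=> f [vs [w [fth _ _ [Ef _] _]]]; rewrite -Ef in fth.
- by case=> f [[|x a] [u [u' [b []]]]].
Qed.

Lemma idle_end t : idle ~>* t -> t = idle.
Proof.
move=> H1; have it := clos_rt_rt1n _ _ _ _ H1; inversion it as [|y z iy] => //.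
by case: (idle_nf iy).
Qed.

(** * Termination *)

(** Since [sim] cannot occur below another symbol, any other step is a calculation, which collapses
    a non-empty list of arguments to a constant. *)
Lemma size_inner s t : is_term (s : sterm sg) -> s ~> t ->
  (exists k d, s = sim (num (Posz k)) d /\ root k d t) \/ tsize t < tsize s.
Proof.
move=> ts st; elim: st ts => {s t} [s t st|f a t t' b tt' IH] ts.
  case/top_inv: st => [?|ct]; [by left|right].
  by case: ct => f [[|w vs] [v [_ _ // _ -> [-> _]]]] /=; rewrite !ltnS.
right; case: ts => i si; have [j [fj tj _]] := has_sort_arg si.
case: IH => [|[k [d [Et _]]]|lt]; first by exists j.
  have jr : j = result by move: tj; rewrite Et /= => /andP[/eqP].
  by move: si => /= /and3P[ff _ _]; case: (args_neq_result ff fj jr).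
by rewrite /= ltnS !map_cat !sumn_cat /= ltn_add2l ltn_add2r.
Qed.

Lemma root_result k d t : root k d t ->
  t = idle \/ exists k' d', k = k'.+1 /\ t = sim (num (Posz k')) d'.
Proof.
by case=> [k' r tau _|k'|k'|k' L tau _|d']; [right|right|left|left|left] => //;
  eexists _, _.
Qed.

(** Every step either yields [idle] or consumes one unit of fuel; the data may grow arbitrarily. *)
Lemma sim_Acc k d : @has_sort sg d data ->
  Acc (fun t s => s ~> t) (sim (num (Posz k)) d).
Proof.
have Aidle : Acc (fun t s => s ~> t) idle by constructor=> t /idle_nf.
elim: k d => [|k IH] d sd; constructor=> t st.
  case: (root_result (ctx_sim sd st)) => [->|[k' [d' [E _]]]]; first exact: Aidle.
  by discriminate E.
case: (root_result (ctx_sim sd st)) => [->|[k' [d' [E Et]]]]; first exact: Aidle.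
case: E => E; rewrite Et -E; apply: IH.
have : @has_sort sg t result.
  by apply: (ctx_sort top_rulesP st); rewrite /= sd.
by rewrite Et => /and3P[_ _ /and3P[]].
Qed.

(** Calculations shrink the term until a [sim] step at the root fires, and from there on the fuel
    bounds the sequence. *)
Lemma term_Acc (s : sterm sg) : is_term s -> Acc (fun t s => s ~> t) s.
Proof.
have [n] := ubnP (tsize s); elim: n s => [|n IH] s lt ts; first by exfalso.
constructor=> t st; case: (size_inner ts st) => [[k [d [Es _]]]|lt'].
  have sd : @has_sort sg d data.
    by case: ts => i; rewrite Es => /and3P[_ _ /and3P[]].
  by move: st; rewrite Es; case: (sim_Acc k sd); apply.
apply: IH; first exact: leq_trans lt' lt.
by case: ts => i si; exists i; apply: (ctx_sort top_rulesP st si).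
Qed.

Lemma sim_terminating : terminating (lctrs_of sim_wf).
Proof.
case=> u ustep.
have noAcc s : Acc (fun t s => s ~> t) s -> forall n, u n = s -> False.
  elim=> {}s _ IH n E.
  apply: (IH (u n.+1)) (erefl (u n.+1)).
  by rewrite -E; apply: step_ctx (ustep n).
have u0 : is_term (u 0) by case: (ustep 0).
exact: noAcc (term_Acc u0) 0 erefl.
Qed.

(** * Local confluence *)

Hypothesis M_clash :
  forall r1 r2, List.In r1 M -> List.In r2 M -> r1 = r2 \/ clash r1.1 r2.1.
Hypothesis M_neq_leaf : forall r, List.In r M -> clash r.1 PL.
Hypothesis H_clash :
  forall r L, List.In r M -> List.In L H -> clash r.1 L.

(** Distinct machine rules clash with each other and with the halting patterns, and all halting and
    timeout steps yield [idle]. Competing results are left only at [leaf]. *)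
Lemma root_det k d t u : root k d t -> root k d u -> d = leaf \/ t = u.
Proof.
move=> rt; case: rt u => {k d t} [k r tau Mr|k|k|k L tau HL|d] u ru;
  [ |by left|by left| | ]; inversion ru as
    [k' r' tau' Mr' Ek Ed|k' Ek Ed|k' Ek Ed|k' L' tau' HL' Ek Ed|]; subst.
- case: (M_clash Mr Mr') => [Er|cl]; last by case: (clashP cl (esym Ed)).
  (* The two matching substitutions agree on the variables of the left-hand side, which include
     those of the right-hand side. *)
  subst r'; right; congr sim; apply: eq_papp => i ir; symmetry.
  exact: papp_inj Ed _ (M_vars Mr ir).
- by left.
- by left.
- by case: (clashP (H_clash Mr HL') (esym Ed)).
- by case: (clashP (H_clash Mr' HL) Ed).
- by left.
- by left.
- by right.
- by right.
Qed.

Lemma root_leaf k t : root k leaf t ->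
  t = idle \/ exists2 k', k = k'.+1 & t = sim (num (Posz k')) (pterm start).
Proof.
move E: leaf => d rt; case: rt E => {k d t} [k r tau Mr|k|k|k L tau _|d] E.
- by case: (clashP (M_neq_leaf Mr) (tau2 := tau) (esym E)).
- by right; exists k.
- by left.
- by left.
- by left.
Qed.

(** The only nontrivial root peak is the one at [leaf], between [idle] and the initial
    configuration; by assumption the latter reaches [idle] with whatever fuel is left. *)
Lemma sim_locally_confluent :
  (forall k, sim (num (Posz k)) (pterm start) ~>* idle) ->
  locally_confluent (lctrs_of sim_wf).
Proof.
move=> toidle s t u st su; have ts : is_term s by case: st.
suff [v [tv uv]] : joinable top t u.
  have wt w : step (@lrules (lctrs_of sim_wf)) s w -> is_term w.
    by case: ts => i si /step_ctx sw; exists i; apply: (ctx_sort top_rulesP sw si).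
  by exists v; split; apply: (rtc_ctx_step top_rulesP) => //; apply: wt.
apply: (innermost_peak_joinable (W := @is_term sg)) (step_ctx st) (step_ctx su)
  => //.
- by move=> f a x b [i /has_sort_arg[j [_ xj _]]]; exists j.
- by move=> f a x b y z; apply: root_args_nf.
move=> {s t u st su ts} s t u ts /top_inv[[k [d [Es rt]]]|ct] /top_inv[].
- case=> k' [d' []]; rewrite {}Es => -[<- <-] ru.
  case: (root_det rt ru) => [Ed|->]; last by exists u; split; apply: rt_refl.
  subst d; case: (root_leaf rt) (root_leaf ru) => [->|[k1 _ ->]] [->|[k2 Ek ->]].
  + by exists idle; split; apply: rt_refl.
  + by exists idle; split; [apply: rt_refl|apply: toidle].
  + by exists idle; split; [apply: toidle|apply: rt_refl].
  + by exists idle; split; apply: toidle.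
- by case=> f [vs [v [fth _ _ Es' _]]]; rewrite Es in Es'; case: Es' fth => <-.
- by case=> k [d [Es _]]; case: ct => f [vs [v [fth _ _ Es' _]]];
    rewrite Es in Es'; case: Es' fth => <-.
(* Two calculations at the root share their redex, hence their arguments and their result. *)
- case: ct => f [vs [v [_ _ _ Es [-> ->]]]] [f' [vs' [v' [_ _ _ Es' [-> ->]]]]].
  have [Ef Em] : f = f' /\
      [seq App v [::] : tm | v <- vs] = [seq App v [::] | v <- vs'].
    by rewrite Es in Es'; case: Es'.
  have Evs : vs = vs' by apply: inj_map Em => x y [].
  by subst f' vs'; eexists; split; apply: rt_refl.
Qed.

(** * Simulation of machine runs on trees *)

Fixpoint tterm (t : tree) : tm :=
  if t is Node a b then node (tterm a) (tterm b) else leaf.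

Fixpoint inst (rho : nat -> tree) (p : pat) : tree :=
  match p with
  | PV i => rho i
  | PL => Leaf
  | PN p q => Node (inst rho p) (inst rho q)
  end.

Lemma tterm_inst rho p : tterm (inst rho p) = papp (tterm \o rho) p.
Proof. by elim: p => //= p -> q ->. Qed.

Lemma tterm_sort t : @has_sort sg (tterm t) data.
Proof. by elim: t => //= a -> b ->. Qed.

Definition mstep (d d' : tree) : Prop :=
  exists r rho, [/\ List.In r M, d = inst rho r.1 & d' = inst rho r.2].

Lemma mstep_root k d d' : mstep d d' ->
  root k.+1 (tterm d) (sim (num (Posz k)) (tterm d')).
Proof.
by case=> r [rho [Mr -> ->]]; rewrite !tterm_inst; apply: root_run.
Qed.

Lemma mstep_top k d d' : mstep d d' ->
  top (sim (num (Posz k.+1)) (tterm d)) (sim (num (Posz k)) (tterm d')).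
Proof.
case=> r [rho [Mr -> ->]]; rewrite !tterm_inst; apply: run_top => // i.
exact: tterm_sort.
Qed.

Lemma mstep_neq_leaf d d' : mstep d d' -> tterm d <> leaf.
Proof.
case=> r [rho [Mr -> _]]; rewrite tterm_inst.
exact: (clashP (M_neq_leaf Mr) (tau2 := tterm \o rho)).
Qed.

(** Either the fuel suffices and the halting rule applies at the end, or it runs out on the way and
    the timeout rule applies; both lead to [idle]. *)
Lemma halt_reaches_idle d rho L k : clos_refl_trans _ mstep d (inst rho L) ->
  List.In L H -> sim (num (Posz k)) (tterm d) ~>* idle.
Proof.
move=> run HL; move: d run k; apply: clos_refl_trans_ind_right.
  case=> [|k]; apply/rt_step/ctx_top.
    exact/timeout_top/tterm_sort.
  rewrite tterm_inst; apply: halt_top; first by right.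
  by move=> i; apply: tterm_sort.
move=> d d' dd' IH _ [|k].
  exact/rt_step/ctx_top/timeout_top/tterm_sort.
by apply: rt_trans (IH k); apply/rt_step/ctx_top/mstep_top.
Qed.

(** Reductions along the run are deterministic, because [leaf] is no source of a machine step. Hence
    they must pass through the stuck configuration if the fuel lasts that long. *)
Lemma stuck_avoids_idle d d' : clos_refl_trans _ mstep d d' ->
  (forall k t, ~ root k.+1 (tterm d') t) ->
  exists k, forall t, sim (num (Posz k)) (tterm d) ~>* t -> t <> idle.
Proof.
move=> run stuck; move: d run; apply: clos_refl_trans_ind_right.
  (* One unit of fuel has to remain in the stuck configuration: with fuel 0 the timeout rule would
     apply. *)
  exists 1 => t H1; have st := clos_rt_rt1n _ _ _ _ H1; inversion st as [|y z sy] => //.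
  by have /stuck := ctx_sim (tterm_sort _) sy.
move=> d e de [k IH] _; exists k.+1 => t H1.
have st := clos_rt_rt1n _ _ _ _ H1; inversion st as [|y z sy yz] => //.
have ry := ctx_sim (tterm_sort _) sy; apply: IH; apply: clos_rt1n_rt.
by case: (root_det ry (mstep_root k de)) => [/(mstep_neq_leaf de)|<-].
Qed.

Lemma clash_no_root P rho k t : clash PL P ->
  (forall r, List.In r M -> clash r.1 P) -> (forall L, List.In L H -> clash L P) ->
  ~ root k.+1 (tterm (inst rho P)) t.
Proof.
rewrite tterm_inst => PLP MP HP rt.
inversion rt as [k' r tau Mr Ek Ed|k' Ek Ed|k' Ek Ed|k' L tau HL Ek Ed|].
- exact: clashP (MP _ Mr) Ed.
- exact: (@clashP _ _ (fun=> leaf) _ PLP Ed).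
- exact: (@clashP _ _ (fun=> leaf) _ PLP Ed).
- exact: clashP (HP _ HL) Ed.
Qed.

(** The start peak at [leaf], with one more unit of fuel than the run needs to stay away from
    [idle], is not joinable, since [idle] is a normal form. *)
Lemma stuck_not_locally_confluent d d' : pterm start = tterm d ->
  clos_refl_trans _ mstep d d' -> (forall k t, ~ root k.+1 (tterm d') t) ->
  ~ locally_confluent (lctrs_of sim_wf).
Proof.
move=> Ed /stuck_avoids_idle H1 /H1[k avoid] lc.
have ts : @is_term sg (sim (num (Posz k.+1)) leaf) by exists result.
have [||v [idlev startv]] := lc (sim (num (Posz k.+1)) leaf) idle
  (sim (num (Posz k)) (pterm start)).
- apply: (ctx_step ts); apply: ctx_top.
  by apply: (@halt_top k PL (fun=> leaf)); first by left.
- by apply: (ctx_step ts); apply/ctx_top/start_top.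
rewrite Ed in startv; apply: avoid (rtc_step_ctx startv) _.
exact: idle_end (rtc_step_ctx idlev).
Qed.

End Simulator.

(** * The machine *)

Fixpoint pat_of (t : tree) : pat :=
  if t is Node a b then PN (pat_of a) (pat_of b) else PL.

Lemma pterm_pat_of t : pterm (pat_of t) = tterm t.
Proof. by elim: t => //= a <- b <-. Qed.

Lemma pvars_pat_of t : pvars (pat_of t) = [::].
Proof. by elim: t => //= a -> b ->. Qed.

(** A configuration enters the presentation as a term, and that term as data is again a tree. This
    tree is what the machine must produce from [t]. *)
Definition quote (t : tree) : tree := enc_term (tterm t).

(** Remaining instructions, operand stack and store. *)
Definition cfg (K st S : tree) : tree := Node K (Node st S).
Definition instr (k : nat) (a : tree) : tree := Node (enc_nat k) a.

(** [iGet] pushes the whole store and [iSet] pops a new one. [iTest c e] pops the value of a loop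
    condition and, unless it is [Leaf], schedules the body [c], the condition [e] and itself.
    [iQuote] replaces the top [t] of the stack by [quote t]. *)
Definition iGet : tree := instr 0 Leaf.
Definition iPush (c : tree) : tree := instr 1 c.
Definition iCons : tree := instr 2 Leaf.
Definition iHd : tree := instr 3 Leaf.
Definition iTl : tree := instr 4 Leaf.
Definition iSet : tree := instr 5 Leaf.
Definition iSeq (a b : tree) : tree := instr 6 (Node a b).
Definition iTest (c e : tree) : tree := instr 7 (Node c e).
Definition iQuote : tree := instr 8 Leaf.

Definition pcfg (K st S : pat) : pat := PN K (PN st S).
Definition pinstr (k : nat) (a : pat) : pat := PN (pat_of (enc_nat k)) a.

(* A rule for the instruction [k] with operand [a], the variables 0, 1 and 2
   standing for the remaining instructions, stack and store. *)
Definition op (k : nat) (a st K' st' S' : pat) : pat * pat :=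
  (pcfg (PN (pinstr k a) (PV 0)) st (PV 2), pcfg K' st' S').

(** Quoting a [Node] takes many steps: its rule schedules pushes of the parts of the encoded term,
    recursive quotations of the two subtrees, and four [iCons] assembling the result. *)
Definition machine : seq (pat * pat) :=
  let K := PV 0 in let st := PV 1 in let S := PV 2 in
  let a := PV 3 in let b := PV 4 in
  let push c := pinstr 1 c in let cons := pinstr 2 PL in
  let quot := pinstr 8 PL in
  let tag := pat_of (enc_bool true) in
  [:: op 0 PL st K (PN S st) S;
      op 1 a st K (PN a st) S;
      op 2 PL (PN b (PN a st)) K (PN (PN a b) st) S;
      op 3 PL (PN PL st) K (PN PL st) S;
      op 3 PL (PN (PN a b) st) K (PN a st) S;
      op 4 PL (PN PL st) K (PN PL st) S;
      op 4 PL (PN (PN a b) st) K (PN b st) S;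
      op 5 PL (PN a st) K st a;
      op 6 (PN a b) st (PN a (PN b K)) st S;
      op 7 (PN a b) (PN PL st) K st S;
      op 7 (PN a b) (PN (PN (PV 5) (PV 6)) st)
        (PN a (PN (pinstr 6 (PN b (pinstr 7 (PN a b)))) K)) st S;
      op 8 PL (PN PL st) K (PN (pat_of (quote Leaf)) st) S;
      op 8 PL (PN (PN a b) st)
        (PN (push tag) (PN (push (pat_of (enc_sym (Fn 1))))
        (PN (push a) (PN quot (PN (push b) (PN quot (PN (push PL)
        (PN cons (PN cons (PN cons (PN cons K))))))))))) st S].

(** The top of the stack is the answer [Leaf], that is, [enc_bool false]. *)
Definition halted : pat := pcfg PL (PN PL (PV 1)) (PV 2).

Lemma machine_vars r : List.In r machine -> {subset pvars r.2 <= pvars r.1}.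
Proof. by move=> Mr; do ?[case: Mr => [<-|Mr]]; try exact/allP. Qed.

Lemma machine_clash r1 r2 : List.In r1 machine -> List.In r2 machine ->
  r1 = r2 \/ clash r1.1 r2.1.
Proof.
move=> M1 M2; do ?[case: M1 => [<-|M1]]; try by [];
  do ?[case: M2 => [<-|M2]]; try by [];
  first [by right; vm_compute | by left].
Qed.

Lemma machine_neq_leaf r : List.In r machine -> clash r.1 PL.
Proof. by move=> Mr; do ?[case: Mr => [<-|Mr]]. Qed.

Lemma machine_neq_halted r L : List.In r machine -> List.In L [:: halted] ->
  clash r.1 L.
Proof.
move=> Mr [<-|//]; by do ?[case: Mr => [<-|Mr]].
Qed.

(** The final configuration with the answer [enc_bool true]. *)
Definition stuck : pat := pcfg PL (PN (PN PL PL) PL) (PV 0).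

Lemma machine_neq_stuck r : List.In r machine -> clash r.1 stuck.
Proof. by move=> Mr; do ?[case: Mr => [<-|Mr]]. Qed.

Lemma halted_neq_stuck L : List.In L [:: halted] -> clash L stuck.
Proof. by case=> [<-|]. Qed.

Definition run : tree -> tree -> Prop := clos_refl_trans _ (mstep machine).

Lemma run_trans c d e : run c d -> run d e -> run c e.
Proof. exact: rt_trans. Qed.

(** Giving the values of the pattern variables as a list reduces each instruction to a
    computation. *)
Lemma run_rule_nth i vs d d' : i < size machine ->
  d = inst (nth Leaf vs) (nth (PL, PL) machine i).1 ->
  d' = inst (nth Leaf vs) (nth (PL, PL) machine i).2 -> run d d'.
Proof.
move=> lti -> ->; apply: rt_step; exists (nth (PL, PL) machine i), (nth Leaf vs).
by split=> //; elim: machine i lti => // r s IH [|i]; [left|right; apply: IH].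
Qed.

Section Instructions.
Variables K st S : tree.

Lemma run_get : run (cfg (Node iGet K) st S) (cfg K (Node S st) S).
Proof. exact: (@run_rule_nth 0 [:: K; st; S]). Qed.

Lemma run_push c : run (cfg (Node (iPush c) K) st S) (cfg K (Node c st) S).
Proof. exact: (@run_rule_nth 1 [:: K; st; S; c]). Qed.

Lemma run_cons a b :
  run (cfg (Node iCons K) (Node b (Node a st)) S) (cfg K (Node (Node a b) st) S).
Proof. exact: (@run_rule_nth 2 [:: K; st; S; a; b]). Qed.

Lemma run_hd a :
  run (cfg (Node iHd K) (Node a st) S) (cfg K (Node (left_of a) st) S).
Proof.
by case: a => [|a b]; [exact: (@run_rule_nth 3 [:: K; st; S])
                      |exact: (@run_rule_nth 4 [:: K; st; S; a; b])].
Qed.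

Lemma run_tl a :
  run (cfg (Node iTl K) (Node a st) S) (cfg K (Node (right_of a) st) S).
Proof.
by case: a => [|a b]; [exact: (@run_rule_nth 5 [:: K; st; S])
                      |exact: (@run_rule_nth 6 [:: K; st; S; a; b])].
Qed.

Lemma run_set a : run (cfg (Node iSet K) (Node a st) S) (cfg K st a).
Proof. exact: (@run_rule_nth 7 [:: K; st; S; a]). Qed.

Lemma run_seq a b :
  run (cfg (Node (iSeq a b) K) st S) (cfg (Node a (Node b K)) st S).
Proof. exact: (@run_rule_nth 8 [:: K; st; S; a; b]). Qed.

Lemma run_test_leaf c e :
  run (cfg (Node (iTest c e) K) (Node Leaf st) S) (cfg K st S).
Proof. exact: (@run_rule_nth 9 [:: K; st; S; c; e]). Qed.

Lemma run_test_node c e t : t <> Leaf ->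
  run (cfg (Node (iTest c e) K) (Node t st) S)
      (cfg (Node c (Node (iSeq e (iTest c e)) K)) st S).
Proof.
by case: t => // a b _; exact: (@run_rule_nth 10 [:: K; st; S; c; e; a; b]).
Qed.

End Instructions.

Lemma run_quote t K st S :
  run (cfg (Node iQuote K) (Node t st) S) (cfg K (Node (quote t) st) S).
Proof.
elim: t K st => [|a IHa b IHb] K st.
  exact: (@run_rule_nth 11 [:: K; st; S]).
apply: run_trans (@run_rule_nth 12 [:: K; st; S; a; b] _ _ isT erefl erefl) _.
do 3 apply: run_trans (run_push _ _ _ _) _.
apply: run_trans (IHa _ _) (run_trans (run_push _ _ _ _) _).
apply: run_trans (IHb _ _) (run_trans (run_push _ _ _ _) _).
by do 4 apply: run_trans (run_cons _ _ _ _ _) _; apply: rt_refl.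
Qed.

(** * Compilation of WHILE programs *)

(* The store is kept as the list of the values of the variables, padded with
   [Leaf]s. *)
Definition represents (t : tree) (s : store) : Prop :=
  forall i, left_of (iter i right_of t) = s i.

Fixpoint cdrop (n : nat) : tree :=
  if n is n'.+1 then iSeq (cdrop n') iTl else iGet.

Fixpoint cexpr (e : expr) : tree :=
  match e with
  | EVar n => iSeq (cdrop n) iHd
  | ENil => iPush Leaf
  | ECons e1 e2 => iSeq (cexpr e1) (iSeq (cexpr e2) iCons)
  | EHd e1 => iSeq (cexpr e1) iHd
  | ETl e1 => iSeq (cexpr e1) iTl
  end.

(* Pushes the part of the updated store starting at variable [i], the variable
   to be changed being [X_(i + n)]. *)
Fixpoint cupdate (i n : nat) (e : expr) : tree :=
  if n is n'.+1 then
    iSeq (cexpr (EVar i)) (iSeq (cupdate i.+1 n' e) iCons)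
  else iSeq (cexpr e) (iSeq (cdrop i.+1) iCons).

Fixpoint update_tree (t : tree) (n : nat) (v : tree) : tree :=
  if n is n'.+1 then Node (left_of t) (update_tree (right_of t) n' v)
  else Node v (right_of t).

Fixpoint ccmd (c : cmd) : tree :=
  match c with
  | Assign n e => iSeq (cupdate 0 n e) iSet
  | Seqc c1 c2 => iSeq (ccmd c1) (ccmd c2)
  | While e c1 => iSeq (cexpr e) (iTest (ccmd c1) (cexpr e))
  end.

Lemma run_drop n K st S :
  run (cfg (Node (cdrop n) K) st S) (cfg K (Node (iter n right_of S) st) S).
Proof.
elim: n K => [|n IH] K; first exact: run_get.
apply: run_trans (run_seq _ _ _ _ _) (run_trans (IH _) _).
exact: run_tl.
Qed.

Lemma run_expr e t s K st : represents t s ->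
  run (cfg (Node (cexpr e) K) st t) (cfg K (Node (eval_expr s e) st) t).
Proof.
move=> ts; elim: e K st => [n||e1 IH1 e2 IH2|e IH|e IH] K st /=.
- rewrite -ts; apply: run_trans (run_seq _ _ _ _ _) (run_trans (run_drop _ _ _ _) _).
  exact: run_hd.
- exact: run_push.
- apply: run_trans (run_seq _ _ _ _ _) (run_trans (IH1 _ _) _).
  apply: run_trans (run_seq _ _ _ _ _) (run_trans (IH2 _ _) _).
  exact: run_cons.
- apply: run_trans (run_seq _ _ _ _ _) (run_trans (IH _ _) _).
  exact: run_hd.
- apply: run_trans (run_seq _ _ _ _ _) (run_trans (IH _ _) _).
  exact: run_tl.
Qed.

(** The new list is assembled on the stack while the store stays intact, so [e] and the unchanged
    variables are read from the old store. *)
Lemma run_update i n e t s K st : represents t s ->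
  run (cfg (Node (cupdate i n e) K) st t)
      (cfg K (Node (update_tree (iter i right_of t) n (eval_expr s e)) st) t).
Proof.
move=> ts; elim: n i K st => [|n IH] i K st.
  apply: run_trans (run_seq _ _ _ _ _) (run_trans (run_expr _ _ _ ts) _).
  apply: run_trans (run_seq _ _ _ _ _) (run_trans (run_drop _ _ _ _) _).
  exact: run_cons.
apply: run_trans (run_seq _ _ _ _ _) (run_trans (run_expr _ _ _ ts) _).
apply: run_trans (run_seq _ _ _ _ _) (run_trans (IH _ _ _) _).
rewrite /= ts; exact: run_cons.
Qed.

Lemma represents_update t s n v : represents t s ->
  represents (update_tree t n v) (update s n v).
Proof.
elim: n t s => [|n IH] t s ts [|i].
- by [].
- by rewrite iterSr /= -iterSr ts.
- exact: ts 0.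
(* The right subtree represents the store with all indices shifted by one. *)
- rewrite iterSr; apply: (IH (right_of t) (fun j => s j.+1)) => j.
  by rewrite -iterSr ts.
Qed.

Lemma run_assign n e t s K st : represents t s ->
  exists2 t', represents t' (update s n (eval_expr s e)) &
    run (cfg (Node (ccmd (Assign n e)) K) st t) (cfg K st t').
Proof.
move=> ts; exists (update_tree t n (eval_expr s e)); first exact: represents_update.
apply: run_trans (run_seq _ _ _ _ _) (run_trans (run_update 0 _ _ _ _ ts) _).
exact: run_set.
Qed.

Lemma run_cmd c s s' t K st : exec c s s' -> represents t s ->
  exists2 t', represents t' s' & run (cfg (Node (ccmd c) K) st t) (cfg K st t').
Proof.
move=> cs; elim: cs t K st => {c s s'}.
- by move=> n e s t K st; apply: run_assign.
- move=> c1 c2 s1 s2 s3 _ IH1 _ IH2 t K st ts.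
  have [t1 ts1 run1] := IH1 t (Node (ccmd c2) K) st ts.
  have [t2 ts2 run2] := IH2 t1 K st ts1.
  exists t2 => //; apply: run_trans (run_seq _ _ _ _ _) (run_trans run1 run2).
- move=> e c s es t K st ts; exists t => //.
  apply: run_trans (run_seq _ _ _ _ _) (run_trans (run_expr _ _ _ ts) _).
  rewrite es; exact: run_test_leaf.
- move=> e c s1 s2 s3 es _ IH1 _ IH2 t K st ts.
  (* What [iTest] schedules after the body is exactly the compiled loop. *)
  have [t1 ts1 run1] := IH1 t (Node (ccmd (While e c)) K) st ts.
  have [t2 ts2 run2] := IH2 t1 K st ts1.
  exists t2 => //; apply: run_trans (run_seq _ _ _ _ _) _.
  apply: run_trans (run_expr _ _ _ ts) (run_trans _ (run_trans run1 run2)).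
  exact: run_test_node.
Qed.

(** * Diagonalization *)

Fixpoint const (t : tree) : expr :=
  if t is Node a b then ECons (const a) (const b) else ENil.

Lemma eval_const s t : eval_expr s (const t) = t.
Proof. by elim: t => //= a -> b ->. Qed.

(** The program [x] is its own input: it is both the only instruction and the store. *)
Definition initial (x : tree) : tree := cfg (Node x Leaf) Leaf x.

Definition diag (x : tree) : presentation :=
  sim_presentation (pat_of (initial x)) machine [:: halted].

Definition eapp (f : psym) (es : seq expr) : expr :=
  ECons (const (enc_bool true)) (ECons (const (enc_sym f)) (foldr ECons ENil es)).

Lemma eval_cons s e1 e2 t1 t2 : eval_expr s e1 = t1 -> eval_expr s e2 = t2 ->
  eval_expr s (ECons e1 e2) = Node t1 t2.
Proof. by move=> /= -> ->. Qed.

Lemma eval_eapp s f es ts : map (eval_expr s) es = map (@enc_term) ts ->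
  eval_expr s (eapp f es) = enc_term (App f ts).
Proof.
move=> E; apply: eval_cons; first exact: eval_const.
apply: eval_cons; first exact: eval_const.
by elim: es ts E => [|e es IH] [|t ts] //= [-> /IH->].
Qed.

Lemma eval_eapp2 s f e1 e2 t1 t2 :
  eval_expr s e1 = enc_term t1 -> eval_expr s e2 = enc_term t2 ->
  eval_expr s (eapp f [:: e1; e2]) = enc_term (App f [:: t1; t2]).
Proof.
move=> E1 E2; apply: (@eval_eapp s f [:: e1; e2] [:: t1; t2]).
by rewrite /map E1 E2.
Qed.

(* Computes [enc_presentation (diag x)] when [X_0] is [quote x]. *)
Definition builder : expr :=
  let leafE := eapp (Fn 0) [::] in
  let nodeE a b := eapp (Fn 1) [:: a; b] in
  let initialE := nodeE (nodeE (EVar 0) leafE) (nodeE leafE (EVar 0)) in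
  ECons (const (enc_seq enc_decl sim_decls))
    (ECons (ECons (const (enc_term (sim (Var (SInt, 0)) leaf)))
              (ECons (eapp (Fn 2) [:: const (enc_term (Var (SInt, 1))); initialE])
                 (const (enc_term tick))))
           (const (enc_seq enc_rule (behead (prules (diag Leaf)))))).

(** Only the right-hand side of the first rule depends on [x], so the other rules are constants
    which [diag Leaf] can supply. *)
Lemma eval_builder s x : s 0 = quote x ->
  eval_expr s builder = enc_presentation (diag x).
Proof.
move=> s0; apply: eval_cons; first exact: eval_const.
apply: eval_cons; last exact: eval_const.
apply: eval_cons; first exact: eval_const.
apply: eval_cons; last exact: eval_const.
transitivity (enc_term (sim (Var (SInt, 1)) (tterm (initial x)))).
  2: by rewrite -pterm_pat_of.
have leafE : eval_expr s (eapp (Fn 0) [::]) = enc_term leaf.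
  exact: (@eval_eapp s (Fn 0) [::] [::]).
apply: eval_eapp2; first exact: eval_const.
by do 2 apply: eval_eapp2 => //; apply: eval_eapp2.
Qed.

(** The first five instructions turn the store, initially the code itself, into a list whose only
    entry is its quotation; the last one pushes the answer. *)
Definition code (p : cmd) : tree :=
  foldr iSeq (cexpr (EVar 0))
    [:: iGet; iQuote; iPush Leaf; iCons; iSet;
        ccmd (Assign 0 builder); ccmd p].

Lemma run_code p b (x := code p) : 
  outputs p (enc_presentation (diag x)) b ->
  exists t, run (initial x) (cfg Leaf (Node b Leaf) t).
Proof.
case=> s' ps s'b; pose s := update (fun=> Leaf) 0 (quote x).
have ts : represents (Node (quote x) Leaf) s.
  by case=> [|i] //; rewrite iterSr iter_fix.
have [t1 ts1 run1] := run_assign 0 builder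
  (Node (iSeq (ccmd p) (cexpr (EVar 0))) Leaf) Leaf ts.
(* The builder overwrites [X_0] and leaves no trace of the quotation, so [p] starts in its proper
   initial store. *)
have {}ts1 : represents t1 (update (fun=> Leaf) 0 (enc_presentation (diag x))).
  by move=> i; rewrite ts1 (eval_builder (x := x)) //; case: i.
have [t2 ts2 run2] := run_cmd (Node (cexpr (EVar 0)) Leaf) Leaf ps ts1.
exists t2; rewrite /initial {1}/x /code /=.
apply: run_trans (run_seq _ _ _ _ _) (run_trans (run_get _ _ _) _).
apply: run_trans (run_seq _ _ _ _ _) (run_trans (run_quote _ _ _ _) _).
apply: run_trans (run_seq _ _ _ _ _) (run_trans (run_push _ _ _ _) _).
apply: run_trans (run_seq _ _ _ _ _) (run_trans (run_cons _ _ _ _ _) _).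
apply: run_trans (run_seq _ _ _ _ _) (run_trans (run_set _ _ _ _) _).
apply: run_trans (run_seq _ _ _ _ _) (run_trans run1 _).
apply: run_trans (run_seq _ _ _ _ _) (run_trans run2 _).
rewrite -s'b; exact: run_expr ts2.
Qed.

Theorem theorem1 :
  ~ exists p : cmd,
      forall (P : presentation) (wf : wf_presentation P),
        terminating (lctrs_of wf) ->
        exists b : bool,
          outputs p (enc_presentation P) (enc_bool b) /\
          (b = true <-> locally_confluent (lctrs_of wf)).
Proof.
case=> p decides; pose x := code p.
have closed := pvars_pat_of (initial x).
have startE := pterm_pat_of (initial x).
pose wf : wf_presentation (diag x) :=
  @sim_wf (pat_of (initial x)) machine [:: halted].
have [b [pb lc]] := decides _ wf (sim_terminating closed).
have [t runt] := run_code pb; case: b pb lc runt => _ lc runt.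
  (* The answer [true] ends the run in an instance of [stuck], which refutes local confluence. *)
  apply: (stuck_not_locally_confluent closed machine_vars machine_clash
    machine_neq_leaf machine_neq_halted startE runt); last exact: (proj1 lc erefl).
  move=> k u; exact: (@clash_no_root _ machine [:: halted] stuck (fun=> t) k u isT
    machine_neq_stuck halted_neq_stuck).
(* The answer [false] ends the run in an instance of [halted], with empty remaining stack and store
   [t], so the system is locally confluent after all. *)
suff lcwf : locally_confluent (lctrs_of wf) by discriminate (proj2 lc lcwf).
apply: (sim_locally_confluent closed machine_vars machine_clash
  machine_neq_leaf machine_neq_halted) => k; rewrite startE.
apply: (@halt_reaches_idle (pat_of (initial x)) machine [:: halted] machine_vars
  (initial x) (nth Leaf [:: Leaf; Leaf; t]) halted k runt).
by left.
Qed.
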